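(* Let $A$ be a representation-finite finite-dimensional algebra over a field. Then $\mathcal L_{\mathrm{quot}}(A)$ and $\mathcal L_{\mathrm{sub}}(A)$ are (under the identification of a subcategory $\mathcal C$ with the set $\mathrm{ind}\,\mathcal C$) the lattices of closed sets of two convex geometries on the finite set $\mathrm{ind}\,A$, given by the closure operators $\mathrm{qcl}$ and $\mathrm{scl}$ respectively.
   Context: Modules are finitely generated right modules. All subcategories are full, additive, and closed under isomorphisms and direct summands. $\mathrm{ind}\,A$ is a set of representatives of the isomorphism classes of indecomposable $A$-modules (finite, since $A$ is representation-finite), and $\mathrm{ind}\,\mathcal C$ is the set of members of $\mathrm{ind}\,A$ in $\mathcal C$. $\mathcal L_{\mathrm{quot}}(A)$ (resp. $\mathcal L_{\mathrm{sub}}(A)$) is the lattice, ordered by inclusion, of subcategories of $\mathrm{mod}\,A$ closed under factor modules (resp. submodules). For $\mathcal X\subseteq\mathrm{ind}\,A$, $\mathrm{qcl}(\mathcal X)$ (resp. $\mathrm{scl}(\mathcal X)$) is the set of members of $\mathrm{ind}\,A$ that are factor modules (resp. submodules) of finite direct sums of modules in $\mathcal X$. A closure operator on a set $E$ is a map $c:2^E\to2^E$ with $X\subseteq c(X)$, $X\subseteq Y\Rightarrow c(X)\subseteq c(Y)$, and $c(c(X))=c(X)$; a subset $C$ is closed if $c(C)=C$. A convex geometry is a finite set $E$ with a closure operator $c$ such that $c(\varnothing)=\varnothing$ and anti-exchange holds: for every closed $C$ and distinct $x,y\notin C$, $x\in c(C\cup\{y\})$ implies $y\notin c(C\cup\{x\})$.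 *)

(* Defs.v *)
From Stdlib Require List.
From HB Require Import structures.
From mathcomp Require Import all_boot all_order all_algebra all_field.
From mathcomp Require Import boolp classical_sets cardinality.

Set Implicit Arguments.
Unset Strict Implicit.
Unset Printing Implicit Defensive.

Import GRing.Theory.

Local Open Scope classical_set_scope.
Local Open Scope ring_scope.

Section Modules.
Variable R : pzRingType.
Implicit Types M N U V : lmodType R.

Definition finitely_generated M : Prop :=
  exists (n : nat) (g : 'I_n -> M),
    forall m : M, exists a : 'I_n -> R, m = \sum_(i < n) a i *: g i.

Definition isomorphic M N : Prop :=
  exists f : {linear M -> N}, bijective f.

(* [factor_module M N]: N is a factor module of M (up to isomorphism). *)
Definition factor_module M N : Prop :=
  exists f : {linear M -> N}, forall y : N, exists x : M, f x = y.

(* [submodule M N]: N is a submodule of M (up to isomorphism). *)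
Definition submodule M N : Prop :=
  exists f : {linear N -> M}, injective f.

Definition zero_module M : Prop := forall x : M, x = 0.

Definition indecomposable M : Prop :=
  ~ zero_module M /\
  forall U V, isomorphic M (U * V)%type -> zero_module U \/ zero_module V.

(* A full subcategory is identified with its class of objects. *)
Definition subcategory := lmodType R -> Prop.

Definition subcat_le (C D : subcategory) : Prop := forall M, C M -> D M.

(* Full additive subcategories of the category of finitely generated modules,
   closed under isomorphisms and direct summands. *)
Definition additive_subcategory (C : subcategory) : Prop :=
  [/\ forall M, C M -> finitely_generated M,
      forall M N, isomorphic M N -> C M -> C N,
      forall M, zero_module M -> C M,
      forall M N, C M -> C N -> C (M * N)%type
    & forall M N, C (M * N)%type -> C M /\ C N].

Definition L_quot (C : subcategory) : Prop :=
  additive_subcategory C /\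
  forall M N, finitely_generated N -> factor_module M N -> C M -> C N.

Definition L_sub (C : subcategory) : Prop :=
  additive_subcategory C /\
  forall M N, finitely_generated N -> submodule M N -> C M -> C N.

Definition representation_finite : Prop :=
  exists (n : nat) (X : 'I_n -> lmodType R),
    forall M, finitely_generated M -> indecomposable M ->
      exists i, isomorphic M (X i).

(* [ind : E -> lmodType R] lists representatives of the isomorphism classes of
   finitely generated indecomposable modules, each class exactly once. *)
Definition indecomposable_representatives
    (E : Type) (ind : E -> lmodType R) : Prop :=
  [/\ forall e, finitely_generated (ind e) /\ indecomposable (ind e),
      forall e e', isomorphic (ind e) (ind e') -> e = e'
    & forall M, finitely_generated M -> indecomposable M ->
        exists e, isomorphic M (ind e)].

Section Ind.
Variables (E : Type) (ind : E -> lmodType R).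

Definition ind_of (C : subcategory) : set E := [set e | C (ind e)].

(* ['rV[R]_0] is the zero module. *)
Fixpoint direct_sum (s : seq E) : lmodType R :=
  if s is e :: s' then (ind e * direct_sum s')%type else 'rV[R]_0.

Definition qcl (X : set E) : set E :=
  [set e | exists2 s : seq E, List.Forall X s &
                              factor_module (direct_sum s) (ind e)].

Definition scl (X : set E) : set E :=
  [set e | exists2 s : seq E, List.Forall X s &
                              submodule (direct_sum s) (ind e)].

End Ind.
End Modules.

Section ConvexGeometry.
Variables (E : Type) (c : set E -> set E).

Definition closure_operator : Prop :=
  [/\ forall X, X `<=` c X,
      forall X Y, X `<=` Y -> c X `<=` c Y
    & forall X, c (c X) = c X].

Definition closed_set (C : set E) : Prop := c C = C.

Definition anti_exchange : Prop :=
  forall (C : set E) (x y : E), closed_set C -> x <> y -> ~ C x -> ~ C y ->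
    c (C `|` [set y]) x -> ~ c (C `|` [set x]) y.

Definition convex_geometry : Prop :=
  [/\ finite_set [set: E], closure_operator, c set0 = set0 & anti_exchange].

End ConvexGeometry.

Section Lattices.
Variables (T : Type) (le : T -> T -> Prop) (L : T -> Prop).

Definition is_lattice : Prop :=
  forall x y, L x -> L y ->
    (exists2 m, L m & forall z, L z -> (le z m <-> le z x /\ le z y)) /\
    (exists2 j, L j & forall z, L z -> (le j z <-> le x z /\ le y z)).

(* [phi] restricts to an isomorphism from the lattice [L], ordered by [le],
   onto the lattice of closed sets of [c], ordered by inclusion. *)
Definition lattice_of_closed_sets
    (E : Type) (c : set E -> set E) (phi : T -> set E) : Prop :=
  [/\ is_lattice,
      forall x, L x -> closed_set c (phi x),
      forall X, closed_set c X -> exists2 x, L x & phi x = X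
    & forall x y, L x -> L y -> (le x y <-> phi x `<=` phi y)].

End Lattices.

(* Main.v *)
Require Import Defs.
From HB Require Import structures.
From mathcomp Require Import all_boot all_order all_algebra all_field.
From mathcomp Require Import boolp classical_sets cardinality.

(** Everything except anti-exchange is formal.  Factor modules and submodules
    both give a preorder on modules that contains the isomorphisms and the
    passage to a direct summand and is compatible with direct sums.  For any
    such preorder [Q], the modules [Q]-below a finite direct sum of members of
    [X] form the smallest [Q]-closed subcategory containing [X], and its
    indecomposables are the closure of [X] ([generated_closed], [closureP]).
    As every finitely generated module is a finite direct sum of
    indecomposables ([direct_sum_decomposition]), a subcategory is determined by
    its indecomposables, whence the lattice isomorphism
    ([closed_subcategory_lattice]).

    Anti-exchange for factor modules: suppose [x] is a factor of a sum of
    members of the closed set [C] and copies of [y], and [y] a factor of a sum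
    of members of [C] and copies of [x], where [x <> y].  Let [T] be the trace
    of [C] in [x], the sum of the images of all maps from members of [C].
    Substituting the second presentation into the first, [x] is the sum of [T]
    and of images of endomorphisms of [x] that factor through [y].  These are
    not injective, since otherwise [x] would be a direct summand of [y]
    ([composite_non_injective]).  Long composites of non-injective endomorphisms
    of an indecomposable module of finite dimension vanish
    ([composite_nilpotent], an argument of Harada and Sai), so iterating the
    decomposition gives [x = T] ([nakayama]); then finitely many maps from [C]
    cover [x] ([trace_full]) and [x] lies in [C].

    Submodules are treated dually, with the reject of [C] in [x], the common
    kernel of all maps to members of [C], in place of the trace
    ([conakayama], [reject_trivial]).

    The ground field enters only through
    [finitely_generated_finite_dimensional]: finitely generated modules have a
    dimension of submodules that detects strict inclusions and satisfies
    rank-nullity for endomorphisms.  All other arguments hold over a ring with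
    this property. *)

Set Implicit Arguments.
Unset Strict Implicit.
Unset Printing Implicit Defensive.

Import GRing.Theory.

Local Open Scope classical_set_scope.
Local Open Scope ring_scope.

(** * Submodules and direct sums *)

Section Submodules.
Variable R : pzRingType.
Implicit Types M N : lmodType R.

(** Linear maps given by a formula are obtained through this lemma. *)
Lemma ex_linear M N (f : M -> N) : linear f -> exists g : {linear M -> N}, g =1 f.
Proof.
move=> lin_f; pose mx := GRing.isLinear.Build R M N _ f lin_f.
by exists (HB.pack_for {linear M -> N} f mx).
Qed.

Definition is_submodule M (P : set M) : Prop :=
  P 0 /\ forall a u v, P u -> P v -> P (a *: u + v).

Definition kernel M N (f : M -> N) : set M := [set v | f v = 0].

Section Operations.
Variables (M N : lmodType R) (P : set M).
Hypothesis subP : is_submodule P.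

Lemma submoduleD u v : P u -> P v -> P (u + v).
Proof. by case: subP => _ PZD Pu Pv; rewrite -[u]scale1r; apply: PZD. Qed.

Lemma preimage_submodule (f : {linear N -> M}) : is_submodule (f @^-1` P).
Proof.
case: subP => P0 PZD; split=> [|a u v Pu Pv]; first by rewrite /preimage /= linear0.
by rewrite /preimage /= linearP; apply: PZD.
Qed.

End Operations.

Lemma kernel_submodule M N (f : {linear M -> N}) : is_submodule (kernel f).
Proof.
split=> [|a u v fu0 fv0]; first exact: linear0.
by rewrite /kernel /= linearP fu0 fv0 scaler0 addr0.
Qed.

Lemma range_submodule M N (f : {linear M -> N}) : is_submodule (range f).
Proof.
split=> [|a _ _ [u _ <-] [v _ <-]]; first by exists 0; rewrite ?linear0.
by exists (a *: u + v); rewrite ?linearP.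
Qed.

Lemma linear_injective M N (f : {linear M -> N}) :
  (forall v, f v = 0 -> v = 0) -> injective f.
Proof.
move=> f0 u v fuv; apply/subr0_eq/f0.
by rewrite linearB fuv subrr.
Qed.

Lemma isomorphic_sym M N : isomorphic M N -> isomorphic N M.
Proof.
move=> [f [g fK gK]].
have /ex_linear[h hE] : linear g.
  by move=> a u v; apply: (can_inj fK); rewrite linearP !gK.
by exists h, f => x; rewrite hE ?fK ?gK.
Qed.

Lemma bijective_isomorphic M N (f : {linear M -> N}) :
  injective f -> (forall y, exists x, f x = y) -> isomorphic M N.
Proof.
move=> inj_f surj_f; have [g gK] := choice surj_f; exists f, g => // x.
by apply: inj_f; rewrite gK.
Qed.

Lemma isomorphic_trans M N L :
  isomorphic M N -> isomorphic N L -> isomorphic M L.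
Proof. by move=> [f bf] [g bg]; exists (g \o f); apply: bij_comp. Qed.

Section SubmoduleType.
Variables (M : lmodType R) (P : set M).
Hypothesis subP : is_submodule P.

Record submodule_type := SubmoduleElement
  { submodule_val : M; _ : `[< P submodule_val >] }.

HB.instance Definition _ := [isSub for submodule_val].
HB.instance Definition _ := [Choice of submodule_type by <:].

Lemma submodule_submod_closed : GRing.submod_closed (fun v => `[< P v >]).
Proof.
case: subP => P0 PZD; split=> [|a u v /asboolP Pu /asboolP Pv]; apply/asboolP => //.
exact: PZD.
Qed.

HB.instance Definition _ := GRing.SubChoice_isSubLmodule.Build R M
  (fun v => `[< P v >]) submodule_type
  (GRing.submod_closed_semi submodule_submod_closed).

(** Indecomposability quantifies over module types, so an internal submodule has
    to be realised as a module of its own. *)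
Lemma ex_submodule : exists (U : lmodType R) (i : {linear U -> M}),
  injective i /\ range i = P.
Proof.
exists submodule_type, (val : {linear submodule_type -> M}); split.
  exact: val_inj.
apply/seteqP; split=> v /=; first by move=> [[x Px] _ <-]; apply/asboolP.
by move=> /asboolP Pv; exists (SubmoduleElement Pv).
Qed.

End SubmoduleType.

(** An internal decomposition [M = P + Q] is an isomorphism from the external
    product of [P] and [Q]. *)
Lemma indecomposable_direct_sum M (P Q : set M) : indecomposable M ->
  is_submodule P -> is_submodule Q ->
  (forall v, P v -> Q v -> v = 0) ->
  (forall v, exists p q, [/\ P p, Q q & v = p + q]) ->
  P `<=` [set 0] \/ Q `<=` [set 0].
Proof.
move=> [_ indM] /ex_submodule[U [i [inj_i <-]]] /ex_submodule[V [j [inj_j <-]]].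
move=> disj cover.
have /ex_linear[h hE] : linear (fun w : U * V => i w.1 + j w.2).
  by move=> a u v /=; rewrite !linearP scalerDr addrACA.
have inj_h : injective h.
  apply: linear_injective => -[u v]; rewrite hE /= => uv0.
  have iu0 : i u = 0.
    apply: disj; first by exists u.
    by exists (- v) => //; rewrite linearN; apply/esym/eqP; rewrite -addr_eq0 uv0.
  rewrite iu0 add0r in uv0.
  congr (_, _); first by apply: inj_i; rewrite iu0 linear0.
  by apply: inj_j; rewrite uv0 linear0.
have surj_h m : exists w, h w = m.
  have [_ [_ [[u _ <-] [v _ <-] ->]]] := cover m.
  by exists (u, v); rewrite hE.
have isoUV : isomorphic (U * V)%type M.
  exact: bijective_isomorphic inj_h surj_h.
by case: (indM _ _ (isomorphic_sym isoUV)) => Z; [left|right] => _ [u _ <-] /=;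
  rewrite (Z u) linear0.
Qed.

(** For modules of finite length, the composition length is such a function; it is
    what well-founded arguments on submodules need. *)
Definition length_function M (d : set M -> nat) : Prop :=
  (forall P Q, is_submodule P -> is_submodule Q -> P `<=` Q -> (d P <= d Q)%N) /\
  (forall P Q, is_submodule P -> is_submodule Q -> P `<=` Q ->
     (d Q <= d P)%N -> Q `<=` P).

Definition dimension_function M (d : set M -> nat) : Prop :=
  length_function d /\
  forall f : {linear M -> M}, (d (range f) + d (kernel f))%N = d setT.

Definition finite_dimensional M : Prop :=
  exists d : set M -> nat, dimension_function d.

End Submodules.

(** * Composites of non-injective endomorphisms *)

Section Nilpotency.
Variable R : pzRingType.
Implicit Types M N : lmodType R.

Lemma set0_submodule M : is_submodule [set 0 : M].
Proof. by split=> // a u v -> ->; rewrite scaler0 addr0. Qed.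

Fixpoint composite M (hs : seq {linear M -> M}) : {linear M -> M} :=
  if hs is h :: hs' then h \o composite hs' else idfun.

Lemma composite_cat M (us vs : seq {linear M -> M}) v :
  composite (us ++ vs) v = composite us (composite vs v).
Proof. by elim: us => //= u us ->. Qed.

Section FiniteDimensional.
Variables (M : lmodType R) (d : set M -> nat).
Hypothesis dimd : dimension_function d.

Lemma dimension0 : d [set 0] = 0.
Proof.
case: dimd => _ /(_ idfun); rewrite (_ : range _ = setT).
  rewrite (_ : kernel _ = [set 0]) //.
  by move/eqP; rewrite -{2}[d setT]addn0 eqn_add2l => /eqP.
by apply/seteqP; split=> // v _; exists v.
Qed.

(** Rank-nullity, as for endomorphisms of a vector space. *)
Lemma injective_surjective (f : {linear M -> M}) :
  injective f -> forall v, exists u, f u = v.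
Proof.
move=> inj_f v; case: dimd => -[_ strict] /(_ f).
rewrite (_ : kernel f = [set 0]); last first.
  apply/seteqP; split=> u /=; last by move->; apply: linear0.
  by move=> fu0; apply: inj_f; rewrite fu0 linear0.
rewrite dimension0 addn0 => dE.
have /(_ v I)[u _ <-] : setT `<=` range f; last by exists u.
apply: strict => //; rewrite ?dE //; exact: range_submodule.
Qed.

Hypothesis indM : indecomposable M.

Definition non_injective_word (hs : seq {linear M -> M}) : Prop :=
  List.Forall (fun h : {linear M -> M} => ~ injective h) hs.

(** If the rank did not drop, [u h] would map the image of [v] bijectively onto the
    image of [u h], making the image of [v] a complement of the kernel of [u h].
    Indecomposability then forces [v = 0] or [u h] injective, against a positive
    rank or the choice of [h]. *)
Lemma rank_drop (u v : {linear M -> M}) (h : {linear M -> M}) r : (0 < r)%N ->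
  (d (range u) <= r)%N -> (d (range v) <= r)%N -> ~ injective h ->
  (d (range (u \o h \o v)) < r)%N.
Proof.
case: dimd => -[mono strict] rank r_gt0 ru rv ninj_h; rewrite ltnNge; apply/negP=> r_le.
pose uh : {linear M -> M} := u \o h; pose uhv : {linear M -> M} := uh \o v.
have r_uh : (d (range uh) <= d (range uhv))%N.
  apply: leq_trans r_le; apply: leq_trans ru; apply: mono; try exact: range_submodule.
  by move=> _ [x _ <-]; exists (h x).
have r_v : (d (range v) <= d (range uhv))%N by apply: leq_trans r_le.
(* Equality of ranks turns the inclusions of images and of kernels into
   equalities: the first makes [range v] and [kernel uh] span, the second makes
   them meet trivially. *)
have im_uh : range uh `<=` range uhv.
  apply: strict r_uh; try exact: range_submodule.
  by move=> _ [x _ <-]; exists (v x).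
have ker_uhv : kernel uhv `<=` kernel v.
  apply: strict; try exact: kernel_submodule.
    by move=> x vx0; rewrite /kernel /= /uhv /= vx0 linear0 linear0.
  by rewrite -(leq_add2l (d (range v))) rank -(rank uhv) leq_add2r.
have [] := @indecomposable_direct_sum _ _ (range v) (kernel uh) indM
  (range_submodule v) (kernel_submodule uh).
- by move=> _ [x _ <-] uhvx0; apply: ker_uhv.
- move=> x; have [y _ yE] := im_uh _ (ex_intro2 _ _ x I erefl).
  exists (v y), (x - v y); split; first by exists y.
    apply: etrans (linearB uh _ _) _; apply/eqP; rewrite subr_eq0.
    exact/eqP/esym.
  by rewrite subrKC.
- move=> v0; have := leq_trans r_le (mono _ _ (range_submodule _) (set0_submodule M) _).
  rewrite dimension0 leqNgt r_gt0 => /(_ _)/notF[] // _ [x _ <-] /=.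
  by rewrite (v0 (v x)) ?linear0 //; exists x.
- move=> ker0; apply: ninj_h; apply: linear_injective => x hx0.
  by apply: ker0; rewrite /kernel /= /uh /= hx0 linear0.
Qed.

(** A composite of length [2 n + 1] has the form [u h v] with [u] and [v] of length
    [n], so each lowering of the bound on the rank roughly doubles the length. *)
Lemma composite_rank k : exists n, forall hs, non_injective_word hs ->
  size hs = n -> (d (range (composite hs)) <= d setT - k)%N.
Proof.
case: dimd => -[mono _] _; elim: k => [|k [n IH]].
  by exists 0%N => hs _ _; rewrite subn0; apply: mono => //; exact: range_submodule.
have [dk|dk] := leqP (d setT) k.
  exists n => hs nhs shs; move: (IH hs nhs shs).
  by move: dk (leqW dk); rewrite -!subn_eq0 => /eqP-> /eqP->.
exists (n + n.+1)%N => hs nhs size_hs.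
have [us [h [vs [hsE size_us size_vs]]]] :
    exists us h vs, [/\ hs = us ++ h :: vs, size us = n & size vs = n].
  have := size_drop n hs; rewrite size_hs addKn.
  case dropE: (drop n hs) => [//|h vs] [size_vs]; exists (take n hs), h, vs.
  by rewrite -dropE cat_take_drop size_takel // size_hs leq_addr.
move: nhs; rewrite hsE => /List.Forall_app[nus /List.Forall_cons_iff[nh nvs]].
rewrite (_ : range _ = range (composite us \o h \o composite vs)); last first.
  by apply: (congr1 (fun f => range f)); apply/funext => x; rewrite /= composite_cat.
rewrite subnS -ltnS prednK ?subn_gt0 //.
by apply: rank_drop; rewrite ?subn_gt0 ?IH.
Qed.

Lemma composite_nilpotent : exists n, forall hs, non_injective_word hs ->
  size hs = n -> forall v, composite hs v = 0.
Proof.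
have [n rankn] := composite_rank (d setT); exists n => hs nhs size_hs v.
case: dimd => -[_ strict] _; apply: (strict [set 0] (range (composite hs))).
- exact: set0_submodule.
- exact: range_submodule.
- by move=> _ ->; exists 0; rewrite ?linear0.
- by apply: leq_trans (rankn _ nhs size_hs) _; rewrite subnn.
- by exists v.
Qed.

End FiniteDimensional.
End Nilpotency.

(** * Finite dimension over the ground field *)

(** A subspace of maximal dimension among those contained in [P] exhausts [P]. *)
Lemma ex_vspace (F : fieldType) (V : vectType F) (P : set V) :
  is_submodule P -> exists U : {vspace V}, forall v, v \in U <-> P v.
Proof.
move=> subP; have [P0 PZD] := subP.
pose inP (n : nat) :=
  `[< exists U : {vspace V}, \dim U = n /\ forall v, v \in U -> P v >].
have inP0 : exists n, inP n.
  exists 0%N; apply/asboolP; exists 0%VS; rewrite dimv0; split=> // v.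
  by rewrite memv0 => /eqP->.
have inP_le n : inP n -> (n <= \dim {:V})%N.
  by move=> /asboolP[U [<- _]]; apply/dimvS/subvf.
case: (ex_maxnP inP0 inP_le) => n /asboolP[U [dimU UP]] maxn.
exists U => v; split=> [|Pv]; first exact: UP.
have /maxn : inP (\dim (U + <[v]>)).
  apply/asboolP; exists (U + <[v]>)%VS; split=> // w.
  move=> /memv_addP[u /UP Pu [_ /vlineP[a ->] ->]].
  by rewrite addrC; apply: PZD.
rewrite -dimU => le_dim.
have : (U == U + <[v]>)%VS by rewrite eqEdim addvSl.
by move=> /eqP->; apply: subvP (addvSr _ _) _ (memv_line v).
Qed.

Section FiniteDimensionalAlgebra.
Variables (F : fieldType) (A : falgType F).

(** The unit of the algebra and that of its converse coincide only up to
    unfolding, which plain rewriting does not see. *)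
Lemma unital_scale1 (M : lmodType A^c) (x : M) : ((1 : F)%:A : A^c) *: x = x.
Proof. rewrite [X in X *: _](scale1r (1 : A)); exact: scale1r. Qed.

(** A complement of the kernel of the surjection from a free module of finite rank
    is a copy of [M] as a vector space. *)
Lemma finitely_generated_coordinates (M : lmodType A^c) : finitely_generated M ->
  exists (V : vectType F) (phi : V -> M), bijective phi /\
    forall a u v, phi (a *: u + v) = (a%:A : A^c) *: phi u + phi v.
Proof.
move=> [n [g gen]].
pose phi (v : {ffun 'I_n -> A}) : M := \sum_(i < n) (v i : A^c) *: g i.
have phiP a u v : phi (a *: u + v) = (a%:A : A^c) *: phi u + phi v.
  rewrite /phi scaler_sumr -big_split; apply: eq_bigr => i _ /=.
  rewrite !ffunE scalerDl scalerA; congr (_ *: _ + _).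
  (* The product of the converse ring; scalars are central. *)
  by change (a *: u i = u i * a%:A); rewrite -scalerAr mulr1.
have phi0 : phi 0 = 0.
  by rewrite /phi big1 // => i _; rewrite ffunE scale0r.
have phiD u v : phi (u + v) = phi u + phi v.
  by have := phiP 1 u v; rewrite unital_scale1 scale1r.
have [K KP] : exists K : {vspace {ffun 'I_n -> A}}, forall v, v \in K <-> phi v = 0.
  apply: (@ex_vspace _ _ [set v | phi v = 0]); split=> //= a u v u0 v0.
  by rewrite phiP u0 v0 scaler0 addr0.
exists (subvs_of K^C), (fun v => phi (vsval v)); split; last first.
  by move=> a u v; rewrite linearP phiP.
have inj : injective (fun v : subvs_of K^C => phi (vsval v)).
  move=> u v /= uv; apply/subvs_inj/eqP.
  rewrite -subr_eq0 -memv0 -(capv_compl K) memv_cap.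
  apply/andP; split; last by rewrite memvB ?subvsP.
  by apply/KP/(addIr (phi (vsval v))); rewrite -phiD subrK add0r.
have surj m : exists v : subvs_of K^C, phi (vsval v) = m.
  have [a ->] := gen m; pose v : {ffun 'I_n -> A} := [ffun i => a i].
  have /memv_addP[k kK [w wK vE]] : v \in (K + K^C)%VS by rewrite addv_complf memvf.
  exists (vsproj K^C w); rewrite vsprojK //.
  transitivity (phi v); last by apply: eq_bigr => i _; rewrite ffunE.
  by rewrite vE phiD (iffLR (KP k) kK) add0r.
by have [h hK] := choice surj; exists h => // v; apply: inj; rewrite hK.
Qed.

(** The dimension of a submodule is that of the corresponding subspace of a
    coordinate space. *)
Lemma finitely_generated_finite_dimensional (M : lmodType A^c) :
  finitely_generated M -> finite_dimensional M.
Proof.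
move=> /finitely_generated_coordinates[V [phi [[psi phiK psiK] phiP]]].
have phi0 : phi 0 = 0.
  by apply/(addIr (phi 0)); have := phiP 1 0 0; rewrite unital_scale1 scale1r !add0r.
have psiP a x y : psi ((a%:A : A^c) *: x + y) = a *: psi x + psi y.
  by apply: (can_inj phiK); rewrite phiP !psiK.
(* The subspace assigned to a set that is not a submodule is arbitrary. *)
have /choice[space spaceP] P : exists U : {vspace V},
    is_submodule P -> forall v, v \in U <-> P (phi v).
  have [subP|nsubP] := pselect (is_submodule P); last by exists 0%VS.
  have [|U UP] := @ex_vspace _ _ (phi @^-1` P); last by exists U.
  case: subP => P0 PZD; split; rewrite /preimage /= ?phi0 // => a u v Pu Pv.
  by rewrite phiP; apply: PZD.
have space_le P Q : is_submodule P -> is_submodule Q -> P `<=` Q ->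
    (space P <= space Q)%VS.
  by move=> subP subQ PQ; apply/subvP => v /(spaceP _ subP)/PQ/(spaceP _ subQ).
exists (fun P => \dim (space P)); split=> [|f].
  split=> [P Q sP sQ PQ|P Q sP sQ PQ dQP v Qv].
    exact/dimvS/space_le.
  have /eqP spE : space P == space Q by rewrite eqEdim space_le.
  by rewrite -(psiK v); apply/(spaceP _ sP); rewrite spE;
    apply/(spaceP _ sQ); rewrite psiK.
have [h hE] : exists h : {linear V -> V}, forall v, h v = psi (f (phi v)).
  by apply: ex_linear => a u v; rewrite phiP linearP psiP.
have kerE : space (kernel f) = lker (linfun h).
  apply/vspaceP => v; rewrite memv_ker lfunE hE; apply/idP/eqP.
    move=> /(spaceP _ (kernel_submodule f)); rewrite /kernel /= => ->.
    by rewrite -phi0 phiK.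
  move=> fv0; apply/(spaceP _ (kernel_submodule f)).
  by rewrite /kernel /= -[LHS]psiK fv0.
have imE : space (range f) = limg (linfun h).
  apply/vspaceP => v; apply/idP/memv_imgP.
    move=> /(spaceP _ (range_submodule f))[x _ xE]; exists (psi x); first exact: memvf.
    by rewrite lfunE hE psiK xE phiK.
  move=> [u _ ->]; apply/(spaceP _ (range_submodule f)).
  by exists (phi u) => //; rewrite lfunE hE psiK.
have -> : space setT = fullv.
  by apply/vspaceP => v; rewrite memvf; apply/(spaceP _ (conj I (fun _ _ _ _ _ => I))).
by rewrite kerE imE addnC -[RHS](limg_ker_dim (linfun h)) capfv.
Qed.

End FiniteDimensionalAlgebra.

(** * Products and preorders of modules *)

Section Products.
Variable R : pzRingType.
Implicit Types L M N U V : lmodType R.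

Lemma isomorphic_refl M : isomorphic M M.
Proof. by exists idfun; exists id. Qed.

Lemma isomorphic_prod M M' N N' :
  isomorphic M M' -> isomorphic N N' -> isomorphic (M * N)%type (M' * N')%type.
Proof.
move=> [f [f' fK f'K]] [g [g' gK g'K]].
have /ex_linear[h hE] : linear (fun w : M * N => (f w.1, g w.2)).
  by move=> a u v /=; rewrite !linearP.
exists h, (fun w => (f' w.1, g' w.2)) => -[u v]; rewrite hE /= ?fK ?gK //.
by rewrite f'K g'K.
Qed.

Lemma isomorphic_prodC M N : isomorphic (M * N)%type (N * M)%type.
Proof.
have /ex_linear[h hE] : linear (fun w : M * N => (w.2, w.1)) by [].
by exists h, (fun w => (w.2, w.1)) => -[u v]; rewrite hE.
Qed.

Lemma isomorphic_prodA M N U : isomorphic (M * (N * U))%type (M * N * U)%type.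
Proof.
have /ex_linear[h hE] : linear (fun w : M * (N * U) => (w.1, w.2.1, w.2.2)) by [].
exists h, (fun w => (w.1.1, (w.1.2, w.2))).
  by move=> [u [v w]]; rewrite hE.
by move=> [[u v] w]; rewrite hE.
Qed.

Lemma zero_rV0 : zero_module ('rV[R]_0 : lmodType R).
Proof. by move=> x; apply/matrixP => i []. Qed.

Lemma isomorphic_prod_zero M N : zero_module N -> isomorphic (M * N)%type M.
Proof.
move=> N0; exists fst, (fun u => (u, 0)) => //.
by move=> [u v]; rewrite (N0 v).
Qed.

Lemma isomorphic_zero M N : zero_module M -> zero_module N -> isomorphic M N.
Proof.
move=> M0 N0.
have /ex_linear[h hE] : linear (fun _ : M => 0 : N).
  by move=> a u v; rewrite /= scaler0 addr0.
by exists h, (fun=> 0) => u; rewrite ?(M0 u) ?(N0 u) // hE.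
Qed.

Lemma ex_inl M N : exists i : {linear M -> (M * N)%type}, i =1 fun u => (u, 0).
Proof. by apply: ex_linear => a u v; congr (_, _); rewrite /= scaler0 addr0. Qed.

Lemma ex_inr M N : exists i : {linear N -> (M * N)%type}, i =1 fun u => (0, u).
Proof. by apply: ex_linear => a u v; congr (_, _); rewrite /= scaler0 addr0. Qed.

Lemma ex_pair L M N (f : {linear L -> M}) (g : {linear L -> N}) :
  exists h : {linear L -> (M * N)%type}, h =1 fun u => (f u, g u).
Proof.
have /ex_linear[h hE] : linear (fun u : L => (f u, g u)).
  by move=> a u v; rewrite !linearP.
by exists h.
Qed.

Lemma ex_copair L M N (f : {linear M -> L}) (g : {linear N -> L}) :
  exists h : {linear (M * N)%type -> L}, h =1 fun u => f u.1 + g u.2.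
Proof.
have /ex_linear[h hE] : linear (fun u : M * N => f u.1 + g u.2).
  by move=> a u v; rewrite !linearP scalerDr addrACA.
by exists h.
Qed.

Lemma finitely_generated_factor M N :
  finitely_generated M -> factor_module M N -> finitely_generated N.
Proof.
move=> [n [g gen]] [f surj_f]; exists n, (f \o g) => y.
have [x <-] := surj_f y; have [a ->] := gen x; exists a.
by rewrite linear_sum; apply: eq_bigr => i _; rewrite linearZ.
Qed.

Lemma finitely_generated_prod M N :
  finitely_generated M -> finitely_generated N -> finitely_generated (M * N)%type.
Proof.
move=> [m [g gen_g]] [n [h gen_h]].
exists (m + n)%N,
  (fun k => match split k with inl i => (g i, 0) | inr j => (0, h j) end).
move=> [x y]; have [a ->] := gen_g x; have [b ->] := gen_h y.
exists (fun k => match split k with inl i => a i | inr j => b j end).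
rewrite big_split_ord /=.
have splitl i : split (lshift n i) = inl i by exact: (unsplitK (inl i)).
have splitr j : split (rshift m j) = inr j by exact: (unsplitK (inr j)).
have [i iE] := ex_inl M N; have [j jE] := ex_inr M N.
transitivity (i (\sum_i a i *: g i) + j (\sum_j b j *: h j)).
  by rewrite iE jE /=; congr (_, _); rewrite /= ?addr0 ?add0r.
by rewrite !linear_sum; congr (_ + _); apply: eq_bigr => k _;
  rewrite linearZ ?iE ?jE ?splitl ?splitr.
Qed.

Lemma finitely_generated_summands M N :
  finitely_generated (M * N)%type -> finitely_generated M /\ finitely_generated N.
Proof.
by move=> fgMN; split; apply: finitely_generated_factor fgMN _;
  [exists fst => u; exists (u, 0)|exists snd => u; exists (0, u)].
Qed.

Lemma isomorphic_factor M N : isomorphic M N -> factor_module M N.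
Proof. by move=> [f [g _ gK]]; exists f => y; exists (g y). Qed.

Lemma finitely_generated_zero M : zero_module M -> finitely_generated M.
Proof. by move=> M0; exists 0%N, (fun=> 0) => x; exists (fun=> 0); rewrite big_ord0. Qed.

(** What factor modules and submodules have in common; [Q M N] reads: [N] is a factor
    module, respectively a submodule, of [M]. *)
Definition additive_preorder (Q : lmodType R -> lmodType R -> Prop) : Prop :=
  [/\ forall M N, isomorphic M N -> Q M N,
      forall M N U, Q M N -> Q N U -> Q M U,
      forall M M' N N', Q M M' -> Q N N' -> Q (M * N)%type (M' * N')%type,
      forall M N, Q (M * N)%type M
    & forall M N, zero_module M -> Q M N -> zero_module N].

Lemma factor_module_additive : additive_preorder (@factor_module R).
Proof.
split=> [|M N U [f fs] [g gs]|M M' N N' [f fs] [g gs]|M N|M N M0 [f fs]].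
- exact: isomorphic_factor.
- exists (g \o f) => z; have [y <-] := gs z; have [x <-] := fs y; by exists x.
- have /ex_linear[h hE] : linear (fun w : M * N => (f w.1, g w.2)).
    by move=> a u v /=; rewrite !linearP.
  exists h => -[x y]; have [u <-] := fs x; have [v <-] := gs y.
  by exists (u, v); rewrite hE.
- by exists fst => u; exists (u, 0).
- by move=> y; have [x <-] := fs y; rewrite (M0 x) linear0.
Qed.

Lemma submodule_additive : additive_preorder (@submodule R).
Proof.
split=> [M N /isomorphic_sym[f /bij_inj]|M N U [f fi] [g gi]
        |M M' N N' [f fi] [g gi]|M N|M N M0 [f fi]].
- by exists f.
- by exists (f \o g); apply: inj_comp.
- have /ex_linear[h hE] : linear (fun w : M' * N' => (f w.1, g w.2)).
    by move=> a u v /=; rewrite !linearP.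
  by exists h => -[u v] [u' v']; rewrite !hE /= => -[/fi-> /gi->].
- by have [i iE] := ex_inl M N; exists i => u v; rewrite !iE => -[].
- by move=> y; apply: fi; rewrite !(M0 (f _)).
Qed.

(** Lengths of submodules of [U] are measured on their images in [M]. *)
Lemma proper_submodule_length M U (d : set M -> nat) (i : {linear U -> M}) :
  length_function d ->
  injective i -> ~ (setT `<=` range i) ->
  exists dU : set U -> nat,
    length_function dU /\ (dU setT < d setT)%N.
Proof.
move=> [mono strict] inj_i nsurj.
have sub_im (P : set U) : is_submodule P -> is_submodule (i @` P).
  move=> [P0 PZD]; split=> [|a _ _ [u Pu <-] [v Pv <-]].
    by exists 0; rewrite ?linear0.
  by exists (a *: u + v); rewrite ?linearP //; apply: PZD.
exists (fun P => d (i @` P)); split; first split=> [P Q sP sQ PQ|P Q sP sQ PQ dQP u Qu].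
- by by apply: mono; [exact: sub_im|exact: sub_im|exact: image_subset].
- have [||v Pv /inj_i <- //] := strict _ _ (sub_im _ sP) (sub_im _ sQ) _ dQP (i u).
  + exact: image_subset.
  + by exists u.
- rewrite ltnNge; apply/negP => le_d; apply: nsurj; apply: strict le_d => //.
  exact: range_submodule.
Qed.

End Products.

Arguments zero_rV0 {R}.

Section Closures.
Variables (R : pzRingType) (E : Type) (ind : E -> lmodType R).
Hypothesis indP : indecomposable_representatives ind.
Hypothesis fin_dim : forall M : lmodType R,
  finitely_generated M -> finite_dimensional M.
Implicit Types L M N U V : lmodType R.

Lemma direct_sum_cat s t :
  isomorphic (direct_sum ind (s ++ t)) (direct_sum ind s * direct_sum ind t)%type.
Proof.
elim: s => [|e s IH] /=.
  apply/isomorphic_sym/(isomorphic_trans (isomorphic_prodC _ _)).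
  exact: isomorphic_prod_zero zero_rV0.
exact: isomorphic_trans (isomorphic_prod (isomorphic_refl _) IH) (isomorphic_prodA _ _ _).
Qed.

Lemma direct_sum1 e : isomorphic (direct_sum ind [:: e]) (ind e).
Proof. exact: isomorphic_prod_zero zero_rV0. Qed.

(** Strong induction on the length: both summands of a nontrivial decomposition
    embed as proper submodules. *)
Lemma decompose_length n M (d : set M -> nat) : finitely_generated M ->
  length_function d ->
  (d setT < n)%N -> exists s, isomorphic M (direct_sum ind s).
Proof.
elim: n M d => // n IH M d fgM len_d; rewrite ltnS => d_le.
have [M0|M_neq0] := pselect (zero_module M).
  by exists [::]; apply: isomorphic_zero => //; exact: zero_rV0.
have [indM|] := pselect (indecomposable M).
  case: indP => _ _ /(_ M fgM indM)[e isoMe]; exists [:: e].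
  exact: isomorphic_trans isoMe (isomorphic_sym (direct_sum1 e)).
move=> /not_andP[//|/existsNP[U /existsNP[V /not_implyP[isoM /not_orP[U0 V0]]]]].
have summand U' V' : isomorphic (U' * V')%type M -> ~ zero_module V' ->
    exists s, isomorphic U' (direct_sum ind s).
  move=> [g bij_g] V'0.
  have [i iE] := ex_inl U' V'.
  have [|/(_ _ I) nsurj|dU [len_dU lt_dU]] :=
      @proper_submodule_length _ _ _ _ (g \o i) len_d.
  - by apply: inj_comp (bij_inj bij_g) _ => u v; rewrite !iE => -[].
  - apply: V'0 => v; have [u _] := nsurj (g (0, v)).
    by move=> /(bij_inj bij_g); rewrite iE => -[_ <-].
  apply: (IH _ dU) => //; last exact: leq_trans lt_dU d_le.
  apply: finitely_generated_factor fgM _; case: (factor_module_additive R) => _ ft _ f1 _.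
  apply: ft _ (f1 U' V'); apply: isomorphic_factor; apply: isomorphic_sym.
  by exists g.
have [s isoU] := summand U V (isomorphic_sym isoM) V0.
have [|t isoV] := summand V U _ U0.
  exact: isomorphic_trans (isomorphic_prodC _ _) (isomorphic_sym isoM).
exists (s ++ t); apply: isomorphic_trans isoM _.
exact: isomorphic_trans (isomorphic_prod isoU isoV) (isomorphic_sym (direct_sum_cat s t)).
Qed.

Lemma direct_sum_decomposition M :
  finitely_generated M -> exists s, isomorphic M (direct_sum ind s).
Proof.
move=> fgM; have [d [len_d _]] := fin_dim fgM.
exact: decompose_length fgM len_d (ltnSn _).
Qed.

Lemma finite_indecomposables : representation_finite R -> finite_set [set: E].
Proof.
case: indP => ind_ok ind_inj _ [n [X Xcover]].
have /choice[f fP] e : exists i, isomorphic (ind e) (X i).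
  by case: (ind_ok e) => fg ie; apply: Xcover.
rewrite -[setT](preimage_setT f); apply: finite_preimage.
  move=> e e' _ _ fe; apply: ind_inj; apply: isomorphic_trans (fP e) _.
  by rewrite fe; apply: isomorphic_sym.
exact: finite_finset.
Qed.

Section Preorder.
Variable Q : lmodType R -> lmodType R -> Prop.
Hypothesis addQ : additive_preorder Q.

(** For [Q] the factor module and the submodule relation, this unfolds to [qcl] and
    [scl]. *)
Definition closure_by (X : set E) : set E :=
  [set e | exists2 s : seq E, List.Forall X s & Q (direct_sum ind s) (ind e)].

Definition closed_subcategory (C : subcategory R) : Prop :=
  additive_subcategory C /\
  forall M N, finitely_generated N -> Q M N -> C M -> C N.

Definition generated (X : set E) : subcategory R := fun M =>
  finitely_generated M /\ exists2 s, List.Forall X s & Q (direct_sum ind s) M.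

Lemma generated_ind X e : generated X (ind e) <-> closure_by X e.
Proof. by split=> [[]//|Xe]; split=> //; case: indP => /(_ e)[]. Qed.

(** Transitivity of [Q] gives closure under [Q], and compatibility with products
    gives closure under sums; summands are [Q]-below the sum. *)
Lemma generated_closed X : closed_subcategory (generated X).
Proof.
case: addQ => Qiso Qtrans Qprod Qfst Q0.
have genQ M N : finitely_generated N -> Q M N -> generated X M -> generated X N.
  by move=> fgN QMN [_ [s Xs QsM]]; split=> //; exists s => //; apply: Qtrans QMN.
have fstX M N : generated X (M * N)%type -> generated X M.
  move=> genMN; apply: (genQ _ _ _ (Qfst M N)) => //.
  by case: genMN => /finitely_generated_summands[].
have isoX M N : isomorphic M N -> generated X M -> generated X N.
  move=> isoMN genM; apply: (genQ _ _ _ (Qiso _ _ isoMN)) => //.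
  by case: genM => fgM _; apply: finitely_generated_factor fgM (isomorphic_factor isoMN).
split=> //; split=> //.
- by move=> M [].
- move=> M M0; split; first exact: finitely_generated_zero.
  by exists [::] => //; apply/Qiso/isomorphic_zero => //; exact: zero_rV0.
- move=> M N [fgM [s Xs QsM]] [fgN [t Xt QtN]]; split.
    exact: finitely_generated_prod.
  exists (s ++ t); first by apply/List.Forall_app.
  by apply: Qtrans (Qiso _ _ (direct_sum_cat s t)) _; apply: Qprod.
- move=> M N genMN; split; first exact: fstX genMN.
  by apply: (@fstX N M); apply: isoX genMN; apply: isomorphic_prodC.
Qed.

Lemma direct_sum_in C s : closed_subcategory C ->
  List.Forall (ind_of ind C) s -> C (direct_sum ind s).
Proof.
move=> [[_ _ C0 Cprod _] _]; elim=> [|e t Ce _ Ct] /=; first exact/C0/zero_rV0.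
exact: Cprod.
Qed.

Lemma closed_subcategoryP C M : closed_subcategory C -> finitely_generated M ->
  C M <-> exists2 s, List.Forall (ind_of ind C) s & isomorphic M (direct_sum ind s).
Proof.
move=> closedC fgM; have [[_ Ciso _ _ Csum] _] := closedC; split=> [CM|[s Cs isoM]].
  have [s isoM] := direct_sum_decomposition fgM; exists s => //.
  have := Ciso _ _ isoM CM; elim: s {isoM} => [|e s IH] /= => [_|/Csum[Ce Cs]].
    exact: List.Forall_nil.
  by apply: List.Forall_cons => //; apply: IH.
by apply: Ciso (isomorphic_sym isoM) _; apply: direct_sum_in.
Qed.

Lemma ind_of_closed C : closed_subcategory C -> closure_by (ind_of ind C) `<=` ind_of ind C.
Proof.
move=> closedC e [s Cs Qse]; case: (closedC) => _ CQ.
by apply: CQ Qse _; [case: indP => /(_ e)[]|apply: direct_sum_in].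
Qed.

Lemma closure_extensive X : X `<=` closure_by X.
Proof.
move=> e Xe; exists [:: e]; first by apply: List.Forall_cons.
by case: addQ => Qiso _ _ _ _; apply/Qiso/direct_sum1.
Qed.

(** Idempotence: the indecomposables of the [Q]-closed subcategory generated by [X]
    are exactly the closure of [X]. *)
Lemma closureP : closure_operator closure_by.
Proof.
split=> [X|X Y XY e [s Xs Qse]|X]; first exact: closure_extensive.
  by exists s => //; apply: List.Forall_impl Xs.
apply/seteqP; split; last exact: closure_extensive.
have <- : ind_of ind (generated X) = closure_by X.
  by apply/seteqP; split=> e /generated_ind.
exact: ind_of_closed (generated_closed X).
Qed.

Lemma closure0 : closure_by set0 = set0.
Proof.
apply/seteqP; split=> // e [[|f s] /List.Forall_forall Xs Qse]; last first.
  by case: (Xs f); left.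
case: addQ => _ _ _ _ /(_ _ _ zero_rV0 Qse) ind0.
by have [/(_ e)[_ [nz _]] _ _] := indP; case: nz.
Qed.

(** The join is the intersection of all [Q]-closed subcategories above both. *)
Lemma closed_subcategory_join C D :
  closed_subcategory (fun M => finitely_generated M /\
    forall Z, closed_subcategory Z -> subcat_le C Z -> subcat_le D Z -> Z M).
Proof.
split; first split.
- by move=> M [].
- move=> M N isoMN [fgM joinM]; split.
    exact: finitely_generated_factor fgM (isomorphic_factor isoMN).
  by move=> Z cZ CZ DZ; have := joinM _ cZ CZ DZ; case: cZ => -[_ + _ _ _] _; apply.
- move=> M M0; split=> [|Z cZ _ _]; first exact: finitely_generated_zero.
  by case: cZ => -[_ _ + _ _] _; apply.
- move=> M N [fgM jM] [fgN jN]; split=> [|Z cZ CZ DZ].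
    exact: finitely_generated_prod.
  have ZM := jM _ cZ CZ DZ; have ZN := jN _ cZ CZ DZ.
  by case: cZ => -[_ _ _ + _] _; apply.
- move=> M N [fgMN jMN].
  have ZMN Z : closed_subcategory Z -> subcat_le C Z -> subcat_le D Z -> Z M /\ Z N.
    by move=> cZ CZ DZ; have := jMN Z cZ CZ DZ; case: cZ => -[_ _ _ _ +] _; apply.
  split; split.
  + by case/finitely_generated_summands: fgMN.
  + by move=> Z cZ CZ DZ; case: (ZMN Z cZ CZ DZ).
  + by case/finitely_generated_summands: fgMN.
  + by move=> Z cZ CZ DZ; case: (ZMN Z cZ CZ DZ).
- move=> M N fgN QMN [_ jM]; split=> // Z cZ CZ DZ.
  by have := jM Z cZ CZ DZ; case: cZ => _; apply.
Qed.

Lemma closed_subcategory_meet C D : closed_subcategory C -> closed_subcategory D ->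
  closed_subcategory (fun M => C M /\ D M).
Proof.
move=> [[Cfg Ciso C0 Cprod Csum] CQ] [[Dfg Diso D0 Dprod Dsum] DQ].
split; first split.
- by move=> M [/Cfg].
- by move=> M N isoMN [CM DM]; split; [apply: Ciso CM|apply: Diso DM].
- by move=> M M0; split; [apply: C0|apply: D0].
- by move=> M N [CM DM] [CN DN]; split; [apply: Cprod|apply: Dprod].
- by move=> M N [/Csum[CM CN] /Dsum[DM DN]].
- by move=> M N fgN QMN [CM DM]; split; [apply: CQ CM|apply: DQ DM].
Qed.

Lemma closed_subcategory_lattice :
  lattice_of_closed_sets (@subcat_le R) closed_subcategory closure_by (ind_of ind).
Proof.
split=> [C D cC cD|C cC|X closedX|C D cC cD].
- split.
    exists (fun M => C M /\ D M); first exact: closed_subcategory_meet.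
    move=> Z _; split=> [ZCD|[ZC ZD] M ZM]; last by split; [apply: ZC|apply: ZD].
    by split=> M /ZCD[].
  eexists; first exact: (closed_subcategory_join C D).
  move=> Z cZ; split=> [jZ|[CZ DZ] M [_ jM]]; last exact: jM.
  have [[Cfg _ _ _ _] _] := cC; have [[Dfg _ _ _ _] _] := cD.
  split=> M ZM; apply: jZ; split; auto.
- apply/seteqP; split; [exact: ind_of_closed|exact: closure_extensive].
- exists (generated X); first exact: generated_closed.
  rewrite -[RHS]closedX; apply/seteqP; split=> e /generated_ind //.
- split=> [CD e|CD M CM]; first exact: CD.
  have fgM : finitely_generated M by case: cC => -[+ _ _ _ _] _; apply.
  apply/(closed_subcategoryP cD fgM).
  have [s Cs isoM] := iffLR (closed_subcategoryP cC fgM) CM.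
  by exists s => //; apply: List.Forall_impl Cs.
Qed.

End Preorder.
End Closures.

(** * Anti-exchange *)

Section Nakayama.
Variables (R : pzRingType) (M : lmodType R).
Hypothesis finM : finite_dimensional M.
Hypothesis indM : indecomposable M.

(** The non-injective endomorphisms play the part of the radical: if [M] is
    generated by [T] and their images, then [M = T].  Applying a composite [w] to
    such a generation of [M] gives [w M] inside [T] plus the images of the longer
    composites [w h]; since long composites vanish, descending on the length ends
    with the empty composite. *)
Lemma nakayama (T : set M) : is_submodule T ->
  (forall f : {linear M -> M}, T `<=` f @^-1` T) ->
  (forall P, is_submodule P -> T `<=` P ->
     (forall h : {linear M -> M}, ~ injective h -> range h `<=` P) ->
     setT `<=` P) ->
  setT `<=` T.
Proof.
move=> subT stableT gen; have [d dimd] := finM.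
have [n nil] := composite_nilpotent dimd indM.
suff words k hs : non_injective_word hs -> (size hs + k)%N = n ->
    setT `<=` composite hs @^-1` T.
  exact: (words n [::] (List.Forall_nil _) erefl).
elim: k hs => [|k IH] hs nhs size_hs.
  by rewrite addn0 in size_hs; move=> v _; rewrite /preimage /= nil //; case: subT.
apply: gen (preimage_submodule subT (composite hs)) (stableT _) _.
move=> h nh _ [v _ <-]; rewrite /preimage /=.
have := IH (hs ++ [:: h]) _ _ v I; rewrite /preimage /= composite_cat; apply.
  by apply/List.Forall_app; split=> //; apply: List.Forall_cons.
by rewrite size_cat -addnA.
Qed.

(** The dual statement, with kernels for images: [T] is killed by every composite,
    by descending induction on the length, as [w v] is killed by all [h] once the
    longer composites [h w] kill [v]. *)
Lemma conakayama (T : set M) :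
  (forall f : {linear M -> M}, T `<=` f @^-1` T) ->
  (forall v, T v -> (forall h : {linear M -> M}, ~ injective h -> h v = 0) ->
     v = 0) ->
  T `<=` [set 0].
Proof.
move=> stableT cogen; have [d dimd] := finM.
have [n nil] := composite_nilpotent dimd indM.
suff words k hs : non_injective_word hs -> (size hs + k)%N = n ->
    T `<=` kernel (composite hs).
  exact: (words n [::] (List.Forall_nil _) erefl).
elim: k hs => [|k IH] hs nhs size_hs v Tv.
  by rewrite addn0 in size_hs; rewrite /kernel /= nil.
apply: cogen; first exact: stableT.
move=> h nh; have := IH (h :: hs) _ _ v Tv; apply.
  exact: List.Forall_cons.
by rewrite addSnnS.
Qed.

End Nakayama.

(** An injective endomorphism of the finite-dimensional [M] is bijective, so [g] would embed [M] as a direct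
    summand of [N], with complement the kernel of [f]. *)
Lemma composite_non_injective (R : pzRingType) (M N : lmodType R)
    (f : {linear N -> M}) (g : {linear M -> N}) :
  finite_dimensional M -> indecomposable M -> indecomposable N ->
  ~ isomorphic N M -> ~ injective (f \o g).
Proof.
move=> [d dimd] [M_neq0 _] indN nisoNM inj_fg.
have surj_fg := injective_surjective dimd inj_fg.
have [] := @indecomposable_direct_sum _ _ (range g) (kernel f) indN
  (range_submodule g) (kernel_submodule f).
- move=> _ [u _ <-] fgu0.
  suff -> : u = 0 by rewrite linear0.
  by apply: inj_fg; rewrite linear0.
- move=> v; have [u fgu] := surj_fg (f v).
  exists (g u), (v - g u); split; first by exists u.
    by rewrite /kernel /= linearB -fgu subrr.
  by rewrite subrKC.
- move=> g0; apply: M_neq0 => u; apply: inj_fg; rewrite linear0 /=.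
  by rewrite (g0 (g u)) ?linear0 //; exists u.
- move=> ker0; apply: nisoNM; apply: bijective_isomorphic.
    by apply: linear_injective => v /ker0.
  by move=> u; have [v <-] := surj_fg u; exists (g v).
Qed.

Section AntiExchange.
Variables (R : pzRingType) (E : Type) (ind : E -> lmodType R).
Hypothesis indP : indecomposable_representatives ind.
Hypothesis fin_dim : forall M : lmodType R,
  finitely_generated M -> finite_dimensional M.
Implicit Types (M N : lmodType R) (X : set E).

(** Defined as the smallest submodule containing the images, so that membership
    needs no bookkeeping of finite sums. *)
Definition trace X M : set M :=
  [set v | forall P : set M, is_submodule P ->
    (forall e, X e -> forall h : {linear ind e -> M}, range h `<=` P) -> P v].

Definition reject X M : set M :=
  [set v | forall e, X e -> forall h : {linear M -> ind e}, h v = 0].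

Arguments trace : clear implicits.
Arguments reject : clear implicits.

Lemma trace_submodule X M : is_submodule (trace X M).
Proof.
split=> [P [P0 _] _|a u v Tu Tv P subP XP]; first exact: P0.
by case: (subP) => _; apply; [apply: Tu|apply: Tv].
Qed.

Lemma range_trace X M e (h : {linear ind e -> M}) : X e -> range h `<=` trace X M.
Proof. by move=> Xe v hv P _ XP; apply: XP hv. Qed.

Lemma trace_functorial X M N (f : {linear M -> N}) :
  trace X M `<=` f @^-1` trace X N.
Proof.
move=> v Tv P subP XP; apply: (Tv (f @^-1` P)) (preimage_submodule subP f) _.
by move=> e Xe h _ [u _ <-]; apply: (XP e Xe (f \o h)); exists u.
Qed.

Lemma reject_functorial X M N (f : {linear M -> N}) :
  reject X M `<=` f @^-1` reject X N.
Proof. by move=> v Tv e Xe h; apply: (Tv e Xe (h \o f)). Qed.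

(** Maps out of a direct sum are controlled by their components. *)
Lemma range_direct_sum s M (P : set M) (f : {linear direct_sum ind s -> M}) :
  is_submodule P ->
  List.Forall (fun e => forall h : {linear ind e -> M}, range h `<=` P) s ->
  range f `<=` P.
Proof.
move=> subP; elim: s f => [|e s IH] f Ps _ [u _ <-].
  by rewrite (zero_rV0 u) linear0; case: subP.
move: Ps => /List.Forall_cons_iff[Pe Ps]; case: u => m w.
have [i iE] := ex_inl (ind e) (direct_sum ind s).
have [j jE] := ex_inr (ind e) (direct_sum ind s).
have -> : (m, w) = i m + j w by rewrite iE jE; congr (_, _); rewrite /= ?addr0 ?add0r.
rewrite linearD; apply: submoduleD => //.
  by apply: (Pe (f \o i)); exists m.
by apply: (IH (f \o j) Ps); exists w.
Qed.

Lemma kernel_direct_sum s M (f : {linear M -> direct_sum ind s}) v :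
  List.Forall (fun e => forall h : {linear M -> ind e}, h v = 0) s -> f v = 0.
Proof.
elim: s f => [|e s IH] f; first by move=> _; apply: zero_rV0.
move=> /List.Forall_cons_iff[Pe Ps].
rewrite [f v]surjective_pairing; congr (_, _); first exact: (Pe (fst \o f)).
exact: (IH (snd \o f) Ps).
Qed.

(** A map of maximal rank from a sum of members of [X] is onto: a missing element
    would give a further summand that enlarges the image. *)
Lemma trace_full X M : finite_dimensional M -> setT `<=` trace X M ->
  exists2 s, List.Forall X s & factor_module (direct_sum ind s) M.
Proof.
move=> [d [[mono strict] _]] full.
pose attained n := `[< exists s (f : {linear direct_sum ind s -> M}),
  List.Forall X s /\ d (range f) = n >].
have attained0 : exists n, attained n.
  have [f _] : exists f : {linear direct_sum ind [::] -> M}, f =1 fun=> 0.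
    by apply: ex_linear => a u v; rewrite scaler0 addr0.
  by exists (d (range f)); apply/asboolP; exists [::], f.
have attained_le n : attained n -> (n <= d setT)%N.
  by move=> /asboolP[s [f [_ <-]]]; apply: mono => //; exact: range_submodule.
case: (ex_maxnP attained0 attained_le) => n /asboolP[s [f [Xs <-]]] max_f.
exists s => //; exists f => y.
suff [x _ <-] : range f y by exists x.
apply: (full y I) (range_submodule f) _ => e Xe h _ [u _ <-].
have [k kE] := ex_copair h f.
have le_range : range f `<=` range k.
  by move=> _ [w _ <-]; exists (0, w); rewrite // kE linear0 add0r.
apply: (strict _ _ (range_submodule f) (range_submodule k) le_range); last first.
  by exists (u, 0); rewrite // kE linear0 addr0.
by apply: max_f; apply/asboolP; exists (e :: s), k; split=> //; apply: List.Forall_cons.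
Qed.

(** A map with kernel of minimal dimension into a sum of members of [X] is
    injective: a nonzero element of the kernel would be detected by a further
    summand that shrinks it. *)
Lemma reject_trivial X M : finite_dimensional M -> reject X M `<=` [set 0] ->
  exists2 s, List.Forall X s & submodule (direct_sum ind s) M.
Proof.
move=> [d [[mono strict] _]] triv.
pose attained n := `[< exists s (f : {linear M -> direct_sum ind s}),
  List.Forall X s /\ d (kernel f) = n >].
have attained0 : exists n, attained n.
  have [f _] : exists f : {linear M -> direct_sum ind [::]}, f =1 fun=> 0.
    by apply: ex_linear => a u v; rewrite scaler0 addr0.
  by exists (d (kernel f)); apply/asboolP; exists [::], f.
case: (ex_minnP attained0) => n /asboolP[s [f [Xs <-]]] min_f.
exists s => //; exists f; apply: linear_injective => v fv0.
apply: triv => e Xe h; have [k kE] := ex_pair h f.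
have le_kernel : kernel k `<=` kernel f by move=> u; rewrite /kernel /= kE => -[].
suff : kernel k v by rewrite /kernel /= kE => -[].
apply: (strict _ _ (kernel_submodule k) (kernel_submodule f) le_kernel) fv0.
by apply: min_f; apply/asboolP; exists (e :: s), k; split=> //; apply: List.Forall_cons.
Qed.

Lemma endomorphism_through_non_injective x y
    (f : {linear ind y -> ind x}) (g : {linear ind x -> ind y}) :
  x <> y -> ~ injective (f \o g).
Proof.
have [ind_ok ind_inj _] := indP; have [fgx indx] := ind_ok x; have [_ indy] := ind_ok y.
move=> neq_xy; apply: composite_non_injective => //; first exact: fin_dim.
by move=> /ind_inj /esym.
Qed.

(** The two presentations generate [x] by the trace of [C] and the images of
    endomorphisms through [y], so [nakayama] makes the trace all of [x]. *)
Lemma qcl_anti_exchange : anti_exchange (qcl ind).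
Proof.
move=> C x y closedC neq_xy nCx _ [s Cs [p surj_p]] [t Ct [q surj_q]].
have [ind_ok _ _] := indP; have [/fin_dim finx indx] := ind_ok x.
apply: nCx; rewrite -closedC; apply: (trace_full finx).
apply: (nakayama finx indx (trace_submodule C _)) => [f|P subP TP hP v _].
  exact: trace_functorial.
have [u <-] := surj_p v; apply: (range_direct_sum subP (f := p)); last by exists u.
apply: List.Forall_impl Cs => e [Ce|->] h; first by move=> w /(range_trace Ce)/TP.
move=> _ [m _ <-]; have [w <-] := surj_q m.
apply: (range_direct_sum (preimage_submodule subP h) (f := q)); last by exists w.
apply: List.Forall_impl Ct => e' [Ce'|->] k _ [m' _ <-].
  by apply: TP; apply: (range_trace (h := h \o k) Ce'); exists m'.
by apply: (hP (h \o k)); [exact: endomorphism_through_non_injective|exists m'].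
Qed.

(** A nonzero element of the reject of [C] in [x] is detected by the maps to [y], and its
    images there by the maps back to [x]. *)
Lemma scl_anti_exchange : anti_exchange (scl ind).
Proof.
move=> C x y closedC neq_xy nCx _ [s Cs [p inj_p]] [t Ct [q inj_q]].
have [ind_ok _ _] := indP; have [/fin_dim finx indx] := ind_ok x.
apply: nCx; rewrite -closedC; apply: (reject_trivial finx).
apply: (conakayama finx indx) => [f|v Tv hv]; first exact: reject_functorial.
apply: inj_p; rewrite linear0; apply: kernel_direct_sum.
apply: List.Forall_impl Cs => e [Ce|->] h; first exact: Tv.
apply: inj_q; rewrite linear0; apply: kernel_direct_sum.
apply: List.Forall_impl Ct => e' [Ce'|->] k; first exact: (Tv e' Ce' (k \o h)).
by apply: (hv (k \o h)); exact: endomorphism_through_non_injective.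
Qed.

End AntiExchange.

Unset Implicit Arguments.

Theorem corollary2p14 (F : fieldType) (A : falgType F)
    (E : Type) (ind : E -> lmodType A^c)
    (repfin : representation_finite A^c)
    (indP : indecomposable_representatives ind) :
  [/\ convex_geometry (qcl ind),
      lattice_of_closed_sets (@subcat_le A^c) (@L_quot A^c)
        (qcl ind) (ind_of ind),
      convex_geometry (scl ind)
    & lattice_of_closed_sets (@subcat_le A^c) (@L_sub A^c)
        (scl ind) (ind_of ind)].
Proof.
have fin_dim := @finitely_generated_finite_dimensional F A.
have addq := factor_module_additive A^c; have adds := submodule_additive A^c.
have finE := finite_indecomposables indP repfin.
split.
- split=> //; [exact: closureP addq|exact: closure0 addq|exact: qcl_anti_exchange].
- exact: closed_subcategory_lattice addq.
- split=> //; [exact: closureP adds|exact: closure0 adds|exact: scl_anti_exchange].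
- exact: closed_subcategory_lattice adds.
Qed.
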